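(* For every real Banach space $X$, $C_B(X)=C'_{\mathrm{NJ}}(X)$, where $$C_B(X)=\sup_{(x,y,\beta)\in\mathcal R_B(X)}\frac{\|x\|^2+\|\beta x+y\|^2}{r(x,y,\beta)^2},\qquad C'_{\mathrm{NJ}}(X)=\sup_{u,v\in S_X}\frac{\|u+v\|^2+\|u-v\|^2}{4}.$$
   Context: $S_X=\{x\in X:\|x\|=1\}$. Birkhoff-James orthogonality: $x\perp_B y$ means $\|x+ty\|\ge\|x\|$ for all $t\in\mathbb{R}$. $\mathcal R_B(X)$ is the set of all triples $(x,y,\beta)\in X\times X\times\mathbb{R}$ such that $x\neq0$, $x\perp_B y$, and $0<\|(1+\beta)x+y\|=\|(1-\beta)x-y\|$. For $(x,y,\beta)\in\mathcal R_B(X)$, $r(x,y,\beta)=\|(1+\beta)x+y\|=\|(1-\beta)x-y\|$. *)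

(* Defs.v *)
From mathcomp Require Import all_boot all_order all_algebra.
From mathcomp Require Import all_classical all_reals all_analysis.
Import Order.TTheory GRing.Theory Num.Theory.
Import numFieldNormedType.Exports.

Set Implicit Arguments.
Unset Strict Implicit.
Unset Printing Implicit Defensive.

Local Open Scope classical_set_scope.
Local Open Scope ring_scope.

Definition unit_sphere (R : realType) (X : normedModType R) : set X :=
  [set x | `|x| = 1].
Arguments unit_sphere {R} X.

Definition bj_orth (R : realType) (X : normedModType R) (x y : X) : Prop :=
  forall t : R, `|x| <= `|x + t *: y|.

Definition RB (R : realType) (X : normedModType R) : set (X * X * R) :=
  [set p | let: (x, y, b) := p in
    [/\ x != 0, bj_orth x y,
        0 < `|(1 + b) *: x + y| &
        `|(1 + b) *: x + y| = `|(1 - b) *: x - y|]].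
Arguments RB {R} X.

(* On [RB X] this is also [`|(1 - b) *: x - y|]. *)
Definition rB (R : realType) (X : normedModType R) (x y : X) (b : R) : R :=
  `|(1 + b) *: x + y|.

(* Suprema are taken in the extended reals, since the real-valued [sup] returns
   0 on unbounded sets. For X = {0} both index sets are empty and both
   constants are -oo. *)
Definition CB (R : realType) (X : normedModType R) : \bar R :=
  ereal_sup [set ((`|p.1.1| ^+ 2 + `|p.2 *: p.1.1 + p.1.2| ^+ 2)
                  / rB p.1.1 p.1.2 p.2 ^+ 2)%:E | p in RB X].
Arguments CB {R} X.

Definition CNJ' (R : realType) (X : normedModType R) : \bar R :=
  ereal_sup [set ((`|p.1 + p.2| ^+ 2 + `|p.1 - p.2| ^+ 2) / 4)%:E
            | p in unit_sphere X `*` unit_sphere X].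
Arguments CNJ' {R} X.

(* Main.v *)
Require Import Defs.
From mathcomp Require Import all_boot all_order all_algebra.
From mathcomp Require Import all_classical all_reals all_analysis.
From mathcomp Require Import ring lra.
Import Order.TTheory GRing.Theory Num.Theory.
Import numFieldNormedType.Exports.

Set Implicit Arguments.
Unset Strict Implicit.
Unset Printing Implicit Defensive.

Local Open Scope classical_set_scope.
Local Open Scope ring_scope.

(** The substitution [u = ((1 + b) x + y) / r], [v = ((1 - b) x - y) / r] sends
    an admissible triple to a pair of unit vectors with [u + v = 2 x / r] and
    [u - v = 2 (b x + y) / r], so the two quotients agree. It is inverted by
    [x = (u + v) / 2] and [b x + y = (u - v) / 2], where a suitable [b] exists
    because some [w - b x] is orthogonal to [x]. This fails only for
    [u + v = 0], but replacing [v] by [- v] does not change the quotient. *)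

(* The one-step Hahn-Banach extension to [span(x, w)] of the norming functional
   of [x]; [c] is its value at [w]. *)
Lemma norming_value (R : realType) (X : normedModType R) (x w : X) :
  exists c : R, forall a : R,
    a * `|x| - `|a *: x - w| <= c /\ c <= `|a *: x + w| - a * `|x|.
Proof.
pose A := [set a * `|x| - `|a *: x - w| | a in [set: R]].
have leA b : ubound A (`|b *: x + w| - b * `|x|).
  move=> _ [a _ <-].
  (* The sum of [a *: x - w] and [b *: x + w] no longer contains [w], so the triangle inequality
     places every lower bound for [c] below every upper bound. *)
  have : `|(a + b) *: x| <= `|a *: x - w| + `|b *: x + w|.
    by apply: le_trans (ler_normD _ _); rewrite addrACA addNr addr0 scalerDl.
  rewrite normrZ => le_ab.
  have := ler_wpM2r (normr_ge0 x) (ler_norm (a + b)).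
  by move: le_ab; rewrite mulrDl; lra.
have A0 : A !=set0 by exists (0 * `|x| - `|0 *: x - w|), 0.
exists (sup A) => a; split.
  by apply: ub_le_sup; [exists (`|0 *: x + w| - 0 * `|x|); exact: leA | exists a].
exact: ge_sup.
Qed.

(** Let [f] be the norming functional, with [f x = |x|] and [f w = c]. For [b = c / |x|] it vanishes
    on [w - b *: x], so [|x| = f (x + t *: (w - b *: x))], which is at most the norm of the
    argument. *)
Lemma bj_orth_subZ (R : realType) (X : normedModType R) (x w : X) :
  x != 0 -> exists b : R, bj_orth x (w - b *: x).
Proof.
move=> x0; have nx0 : `|x| != 0 by rewrite normr_eq0.
have [c hc] := norming_value x w.
exists (c / `|x|) => t; set b := c / `|x|.
have bE : b * `|x| = c by rewrite /b divfK.
have -> : x + t *: (w - b *: x) = (1 - t * b) *: x + t *: w.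
  by rewrite scalerBr scalerA scalerBl scale1r addrA addrAC.
(* Factoring out [|t|] leaves a vector [a *: x - w] if [t < 0] and [a *: x + w] if [t > 0]; the
   lower, respectively upper, bound on [c] then applies. *)
have [t0|t0|->] := ltgtP t 0; last by rewrite mul0r subr0 scale0r addr0 scale1r.
- have s0 : 0 < - t by rewrite oppr_gt0.
  have -> : (1 - t * b) *: x + t *: w = (- t) *: ((b - t^-1) *: x - w).
    rewrite scalerBr scalerA scaleNr opprK; congr (_ *: _ + _).
    by field; rewrite lt_eqF.
  rewrite normrZ gtr0_norm//.
  have [+ _] := hc (b - t^-1); rewrite mulrBl bE => h.
  have : - t * (- (t^-1 * `|x|)) <= - t * `|(b - t^-1) *: x - w|.
    by apply: ler_wpM2l; [exact: ltW | lra].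
  by rewrite mulrNN mulrA divff ?lt_eqF// mul1r.
- have -> : (1 - t * b) *: x + t *: w = t *: ((t^-1 - b) *: x + w).
    rewrite scalerDr scalerA; congr (_ *: _ + _).
    by field; rewrite gt_eqF.
  rewrite normrZ gtr0_norm//.
  have [_ +] := hc (t^-1 - b); rewrite mulrBl bE => h.
  have : t * (t^-1 * `|x|) <= t * `|(t^-1 - b) *: x + w|.
    by apply: ler_wpM2l; [exact: ltW | lra].
  by rewrite mulrA divff ?gt_eqF// mul1r.
Qed.

Lemma RB_quotient (R : realType) (X : normedModType R) (x y : X) (b : R) :
  RB X (x, y, b) -> exists u v : X, [/\ `|u| = 1, `|v| = 1 &
    (`|x| ^+ 2 + `|b *: x + y| ^+ 2) / rB x y b ^+ 2 =
    (`|u + v| ^+ 2 + `|u - v| ^+ 2) / 4].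
Proof.
move=> [_ _]; rewrite -/(rB x y b); set r := rB x y b => r0 rE.
have ri0 : 0 <= r^-1 by rewrite invr_ge0 ltW.
exists (r^-1 *: ((1 + b) *: x + y)), (r^-1 *: ((1 - b) *: x - y)); split.
- by rewrite normrZ ger0_norm// mulVf// gt_eqF.
- by rewrite normrZ ger0_norm// -rE mulVf// gt_eqF.
rewrite -scalerDr -scalerBr !normrZ (ger0_norm ri0).
have -> : (1 + b) *: x + y + ((1 - b) *: x - y) = 2 *: x.
  by rewrite addrACA subrr addr0 -scalerDl; congr (_ *: _); ring.
have -> : (1 + b) *: x + y - ((1 - b) *: x - y) = 2 *: (b *: x + y).
  rewrite opprB [y - _]addrC addrACA -scaleNr -scalerDl scalerDr scalerA.
  by rewrite [2 *: y]scaler_nat mulr2n; congr (_ *: _ + _); ring.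
rewrite !normrZ (ger0_norm (ler0n _ 2)).
by field; rewrite gt_eqF.
Qed.

Lemma sphere_quotient (R : realType) (X : normedModType R) (u v : X) :
  `|u| = 1 -> `|v| = 1 -> u + v != 0 ->
  exists x y b, RB X (x, y, b) /\
    (`|x| ^+ 2 + `|b *: x + y| ^+ 2) / rB x y b ^+ 2 =
    (`|u + v| ^+ 2 + `|u - v| ^+ 2) / 4.
Proof.
move=> u1 v1 uv0.
pose x : X := 2^-1 *: (u + v); pose w : X := 2^-1 *: (u - v).
have x0 : x != 0 by rewrite scaler_eq0 negb_or invr_eq0 pnatr_eq0.
have [b xb] := bj_orth_subZ w x0.
have half (z : X) : 2^-1 *: (z + z) = z.
  by rewrite -mulr2n -[z *+ 2]scaler_nat scalerA mulVf ?pnatr_eq0// scale1r.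
have uE : (1 + b) *: x + (w - b *: x) = u.
  rewrite scalerDl scale1r addrACA subrr addr0 -scalerDr.
  by rewrite addrACA subrr addr0 half.
have vE : (1 - b) *: x - (w - b *: x) = v.
  rewrite scalerBl scale1r opprB addrA subrK -scalerBr opprB.
  by rewrite addrC addrA subrK half.
(* With this [y], [b *: x + y] is [w], and the two vectors of equal norm are [u] and [v], so
   [r = 1]. *)
exists x, (w - b *: x), b; split.
  by split=> //; rewrite uE ?vE u1.
rewrite /rB uE u1 [b *: x + _]addrC subrK !normrZ ger0_norm ?invr_ge0 ?ler0n//.
by field.
Qed.

Theorem theorem4p8 (R : realType) (X : completeNormedModType R) :
  CB X = CNJ' X.
Proof.
congr ereal_sup; apply/seteqP; split.
  move=> _ [[[x y] b] /RB_quotient [u [v [u1 v1 uvE]]] <-].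
  by exists (u, v) => //=; rewrite uvE.
move=> _ [[u v] [/= u1 v1] <-].
have [uv0|uv0] := eqVneq (u + v) 0; last first.
  have [x [y [b [xyb xyE]]]] := sphere_quotient u1 v1 uv0.
  by exists (x, y, b) => //=; rewrite xyE.
(* The pair [(u, - v)] is [(u, u)], with nonzero sum; the sign change only swaps the two squared
   norms. *)
have vE : - v = u by apply/esym/eqP; rewrite -addr_eq0 uv0.
have [||x [y [b [xyb xyE]]]] := @sphere_quotient R X u (- v) u1.
- by rewrite normrN.
- by rewrite vE -mulr2n -[u *+ 2]scaler_nat scaler_eq0 pnatr_eq0 -normr_eq0 u1 oner_eq0.
by exists (x, y, b) => //=; rewrite xyE opprK addrC.
Qed.
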